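(* Consider the system for $\mathbf{x}_{\mathrm{sub}}=(x_1,x_2,x_3,x_4)^\top\in\mathbb{R}^4$ $$\dot{\mathbf{x}}_{\mathrm{sub}}=J_{\mathrm{sub}}\nabla H_0(\mathbf{x}_{\mathrm{sub}})+B_{\mathrm{sub}}\mathbf{d}+C_{\mathrm{sub}}\mathbf{u},\qquad H_0(\mathbf{x}_{\mathrm{sub}})=\frac L2(x_1^2+x_2^2)+\frac C2(x_3^2+x_4^2),$$ with disturbance $\mathbf{d}(t)\in\mathbb{R}^2$, control input $\mathbf{u}(t)\in\mathbb{R}^2$, and the matrices $J_{\mathrm{sub}},B_{\mathrm{sub}},C_{\mathrm{sub}}$ given in the context. Let $\alpha,\beta>0$ be constants, put $\epsilon=\frac{\beta}{\alpha}$, and let $\mathbf{u}=\mathbf{v}+\mathbf{h}(\mathbf{x}_{\mathrm{sub}})$, where $\mathbf{v}(t)\in\mathbb{R}^2$ is an input error and $\mathbf{h}=(h_1,h_2)^\top$ is $$h_1=\frac{A x_1}{x_1^2+x_2^2},\qquad h_2=\frac{A x_2}{x_1^2+x_2^2},$$ $$A=-\Big[\frac{1}{4\alpha\epsilon}(x_3^2+x_4^2)+\alpha\Big(\frac L2(x_1^2+x_2^2)+\frac C2(x_3^2+x_4^2)\Big)\Big].$$ Then $$H_0(\mathbf{x}_{\mathrm{sub}}(T))\le H_0(\mathbf{x}_{\mathrm{sub}}(0))e^{-\rho T}+\frac{\beta}{\rho}\sup\|\mathbf{d}\|^2+\frac{1}{2\rho}\sup\|\mathbf{v}\|^2,$$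 with $\rho=\alpha-\frac1L$. Moreover, if $\alpha>\frac1L$, then $H_0$ remains bounded.
   Context: $L$ (inductance), $C$ (capacitance) and $\omega$ (angular velocity) are positive constants. The suprema are over time and $\|\cdot\|$ is the Euclidean norm. The matrices are $$J_{\mathrm{sub}}=\begin{bmatrix}0&\frac{\omega}{L}&-\frac1{CL}&0\\-\frac{\omega}{L}&0&0&-\frac1{CL}\\\frac1{CL}&0&0&\frac{\omega}{C}\\0&\frac1{CL}&-\frac{\omega}{C}&0\end{bmatrix},\quad B_{\mathrm{sub}}=\begin{bmatrix}0&0\\0&0\\\frac1C&0\\0&\frac1C\end{bmatrix},\quad C_{\mathrm{sub}}=\begin{bmatrix}\frac1L&0\\0&\frac1L\\0&0\\0&0\end{bmatrix}.$$ The formulas for $h_1,h_2$ make sense where $x_1^2+x_2^2\neq0$.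
   Formalization: The estimate is proved only for ρ>0 (α>1/L): for ρ=0 it is undefined, and for ρ<0 it fails at T=0 unless d and v vanish. Boundedness of H₀ is stated for finite sup‖d‖ and sup‖v‖. *)

(* Defs.v *)
From HB Require Import structures.
From mathcomp Require Import all_boot all_order all_algebra.
From mathcomp Require Import all_classical all_reals all_analysis.

Set Implicit Arguments.
Unset Strict Implicit.
Unset Printing Implicit Defensive.
Import Order.TTheory GRing.Theory Num.Theory.
Import numFieldNormedType.Exports.

Local Open Scope classical_set_scope.
Local Open Scope ring_scope.

(* The library norm `|u| on matrices is the sup norm. *)
Definition enorm (R : realType) (n : nat) (u : 'cV[R]_n) : R :=
  Num.sqrt (\sum_i u i 0 ^+ 2).

Definition grad (R : realType) (n : nat) (f : 'cV[R]_n -> R) (p : 'cV[R]_n) :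
    'cV[R]_n :=
  \col_i 'D_(delta_mx i 0) f p.

Definition mx_of_rows (R : realType) (m n : nat) (s : seq (seq R)) :
    'M[R]_(m, n) :=
  \matrix_(i, j) (nth [::] s i)`_j.

(* Indices start at 0: the state (x_1, x_2, x_3, x_4) of the system is
   (x 0 0, x 1 0, x 2 0, x 3 0). *)
Section System.
Variable R : realType.
Variables L C omega : R.

Definition J_sub : 'M[R]_4 := mx_of_rows 4 4
  [:: [::              0;     omega / L; - (C * L)^-1;            0];
      [:: - (omega / L) ;             0;            0; - (C * L)^-1];
      [::     (C * L)^-1;             0;            0;    omega / C];
      [::              0;    (C * L)^-1; - (omega / C);           0]].

Definition B_sub : 'M[R]_(4, 2) := mx_of_rows 4 2
  [:: [::    0;    0];
      [::    0;    0];
      [:: C^-1;    0];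
      [::    0; C^-1]].

Definition C_sub : 'M[R]_(4, 2) := mx_of_rows 4 2
  [:: [:: L^-1;    0];
      [::    0; L^-1];
      [::    0;    0];
      [::    0;    0]].

Definition H0 (x : 'cV[R]_4) : R :=
  L / 2 * (x 0 0 ^+ 2 + x 1 0 ^+ 2) + C / 2 * (x 2 0 ^+ 2 + x 3 0 ^+ 2).

Definition vector_field (x : 'cV[R]_4) (d u : 'cV[R]_2) : 'cV[R]_4 :=
  J_sub *m grad H0 x + B_sub *m d + C_sub *m u.

Definition gainA (alpha eps : R) (x : 'cV[R]_4) : R :=
  - ((4 * alpha * eps)^-1 * (x 2 0 ^+ 2 + x 3 0 ^+ 2)
     + alpha * (L / 2 * (x 0 0 ^+ 2 + x 1 0 ^+ 2)
                + C / 2 * (x 2 0 ^+ 2 + x 3 0 ^+ 2))).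

Definition feedback (alpha eps : R) (x : 'cV[R]_4) : 'cV[R]_2 :=
  mx_of_rows 2 1
    [:: [:: gainA alpha eps x * x 0 0 / (x 0 0 ^+ 2 + x 1 0 ^+ 2)];
        [:: gainA alpha eps x * x 1 0 / (x 0 0 ^+ 2 + x 1 0 ^+ 2)]].

(* x solves the controlled system on the time interval I.  The library
   derivative is two-sided, so the equation is imposed at the interior times,
   and x is continuous up to the endpoints of I that belong to I. *)
Definition solves_on (I : set R) (x : R -> 'cV[R]_4) (d u : R -> 'cV[R]_2) :
    Prop :=
  {within I, continuous x} /\
  (forall t, I° t -> is_derive t (1 : R) x (vector_field (x t) (d t) (u t))).

End System.

(* sup over the times in I of ||w(t)||^2, possibly +oo *)
Definition sup_enorm2 (R : realType) (n : nat) (I : set R)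
    (w : R -> 'cV[R]_n) : \bar R :=
  ereal_sup [set (enorm (w t) ^+ 2)%:E | t in I].

(* Main.v *)
(* H0 is a storage function: along trajectories its derivative is
   x34 . d + x12 . v + A.  Young's inequality with weight beta for x34 . d and 1
   for x12 . v, together with |x12|^2 / 2 <= H0 / L, gives
   H0' <= - rho H0 + beta |d|^2 + |v|^2 / 2, and Gronwall's lemma concludes. *)
Require Import Defs.
From HB Require Import structures.
From mathcomp Require Import all_boot all_order all_algebra.
From mathcomp Require Import all_classical all_reals all_analysis.
From mathcomp Require Import ring lra.

Set Implicit Arguments.
Unset Strict Implicit.
Unset Printing Implicit Defensive.
Import Order.TTheory GRing.Theory Num.Theory.
Import numFieldNormedType.Exports.

Local Open Scope classical_set_scope.
Local Open Scope ring_scope.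

Lemma is_derive_coord (R : realType) (V : normedModType R) (m n : nat)
    (y : V -> 'M[R]_(m, n)) (p v : V) (w : 'M[R]_(m, n)) i j :
  is_derive p v y w -> is_derive p v (fun q => y q i j) (w i j).
Proof.
move=> [yp yw]; apply: DeriveDef; first exact: (derivable_mxP _ _ _).1.
by rewrite -yw derive_mx // mxE.
Qed.

(** The domain [V] and the direction [v] are left general for two uses: [y] the identity with [v] a
    basis vector gives the gradient, and [y] a trajectory with [V] the time line gives the power. *)
Lemma is_derive_H0 (R : realType) (V : normedModType R) (L C : R)
    (y : V -> 'cV[R]_4) (p v : V) (w : 'cV[R]_4) :
  is_derive p v y w ->
  is_derive p v (H0 L C \o y)
    (L * (y p 0 0 * w 0 0 + y p 1 0 * w 1 0) +
     C * (y p 2 0 * w 2 0 + y p 3 0 * w 3 0)).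
Proof.
move=> yw; have cw i := is_derive_coord i 0 yw.
pose c i q : R := y q i 0.
(* As a combination of the coordinate functions [c i], the function is differentiated by instance
   search. *)
have -> : H0 L C \o y = (L / 2) \*: (c 0 ^+ 2 + c 1 ^+ 2)
                        + (C / 2) \*: (c 2 ^+ 2 + c 3 ^+ 2) by [].
have c0 : is_derive p v (c 0) (w 0 0) by exact: cw.
have c1 : is_derive p v (c 1) (w 1 0) by exact: cw.
have c2 : is_derive p v (c 2) (w 2 0) by exact: cw.
have c3 : is_derive p v (c 3) (w 3 0) by exact: cw.
apply: is_derive_eq.
by rewrite /c /= /GRing.scale /=; field.
Qed.

Lemma grad_H0 (R : realType) (L C : R) (p : 'cV[R]_4) :
  grad (H0 L C) p = \col_i [:: L * p 0 0; L * p 1 0; C * p 2 0; C * p 3 0]`_i.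
Proof.
apply/matrixP => i j; rewrite !mxE.
have := is_derive_H0 L C (is_derive_id p (delta_mx i 0)).
move=> /@derive_val ->; rewrite !mxE.
by case: i => [] [|[|[|[|//]]]] ? /=; ring.
Qed.

Lemma continuous_H0 (R : realType) (L C : R) : continuous (H0 L C).
Proof.
move=> p.
have c2 i : (fun q : 'cV[R]_4 => q i 0 ^+ 2) @ p --> p i 0 ^+ 2.
  have c : (fun q : 'cV[R]_4 => q i 0) @ p --> p i 0.
    exact: (coord_continuous (i := i) (j := 0)).
  exact: (cvgM c c).
have cD k i j : (fun q : 'cV[R]_4 => k * (q i 0 ^+ 2 + q j 0 ^+ 2)) @ p -->
    k * (p i 0 ^+ 2 + p j 0 ^+ 2).
  exact: (cvgM (cvg_cst k) (cvgD (c2 i) (c2 j))).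
exact: (cvgD (cD (L / 2) 0 1) (cD (C / 2) 2 3)).
Qed.

(** Integrating factor: [K / rho] is the equilibrium of f' = - rho f + K, and (f - K / rho) e^(rho
    t) has derivative (f' + rho f - K) e^(rho t) <= 0, so it does not increase from [a] to [b]. *)
Lemma gronwall (R : realType) (f df : R -> R) (a b rho K : R) :
  rho != 0 -> a <= b ->
  {within `[a, b], continuous f} ->
  (forall t, t \in `]a, b[ -> is_derive t 1 f (df t)) ->
  (forall t, t \in `]a, b[ -> df t <= - rho * f t + K) ->
  f b <= (f a - K / rho) * expR (- rho * (b - a)) + K / rho.
Proof.
move=> rho0 ab fc fd fle.
pose e (t : R) := expR (rho * t).
have ed (t : R) : is_derive t (1 : R) e (rho * e t).
  have -> : e = expR \o (rho \*: (@id R)) by [].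
  by apply: is_derive_eq; rewrite /= /GRing.scale /= mulr1 mulrC.
pose g := (f - cst (K / rho)) * e.
have gd (t : R) : t \in `]a, b[ ->
    is_derive t (1 : R) g ((df t + rho * f t - K) * e t).
  move=> /fd ft; apply: is_derive_eq.
  rewrite /GRing.scale /= fctE -[(- cst _) t]/(- (K / rho)).
  by field.
have gc : {within `[a, b], continuous g}.
  move=> t; apply: continuousM; last first.
    apply: continuous_subspaceT => s.
    by apply/differentiable_continuous/derivable1_diffP; have [] := ed s.
  by apply: continuousB; [exact: fc|exact: cst_continuous].
have : g b <= g a.
  apply: (@ler0_derive1_le_cc _ g a b _ _ gc); rewrite ?in_itv/= ?lexx ?ab//.
  - by move=> t /gd[].
  - move=> t tab; rewrite derive1E; have /@derive_val -> := gd t tab.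
    rewrite mulr_le0_ge0 ?expR_ge0//; have := fle t tab; lra.
move=> gba; have {gba} : (f b - K / rho) * e b <= (f a - K / rho) * e a := gba.
rewrite /e => gba.
have -> : expR (- rho * (b - a)) = expR (rho * a) / expR (rho * b).
  by rewrite -expRN -expRD; congr expR; ring.
by rewrite mulrA -lerBlDr ler_pdivlMr ?expR_gt0.
Qed.

Lemma sqr_enorm2 (R : realType) (u : 'cV[R]_2) :
  enorm u ^+ 2 = u 0 0 ^+ 2 + u 1 0 ^+ 2.
Proof.
rewrite sqr_sqrtr ?sumr_ge0// => [|i _]; last exact: sqr_ge0.
by rewrite big_ord_recl big_ord1; congr (_ + u _ _ ^+ 2); exact: val_inj.
Qed.

(* The skew J_sub produces no power, and the power x12 . h of the feedback is
   exactly gainA. *)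
Lemma power_balance (R : realType) (L C omega alpha beta : R)
    (p w : 'cV[R]_4) (d v : 'cV[R]_2) :
  0 < L -> 0 < C -> 0 < alpha -> 0 < beta ->
  p 0 0 ^+ 2 + p 1 0 ^+ 2 != 0 ->
  w = vector_field L C omega p d
        (v + feedback L C alpha (beta / alpha) p) ->
  L * (p 0 0 * w 0 0 + p 1 0 * w 1 0) + C * (p 2 0 * w 2 0 + p 3 0 * w 3 0)
  <= - (alpha - L^-1) * H0 L C p
     + (beta * enorm d ^+ 2 + enorm v ^+ 2 / 2).
Proof.
move=> L0 C0 a0 b0 p0 wE.
have -> : L * (p 0 0 * w 0 0 + p 1 0 * w 1 0)
          + C * (p 2 0 * w 2 0 + p 3 0 * w 3 0) =
    p 2 0 * d 0 0 + p 3 0 * d 1 0 + (p 0 0 * v 0 0 + p 1 0 * v 1 0)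
    + gainA L C alpha (beta / alpha) p.
  rewrite wE /vector_field grad_H0.
  rewrite !mxE !big_ord_recl !big_ord0 !mxE /=.
  have lift0 : lift ord0 ord0 = 1 :> 'I_2 by exact: val_inj.
  have ord0E : ord0 = 0 :> 'I_2 by [].
  rewrite !lift0 !ord0E.
  (* The identity holds for any scalar in place of the gain: x12 . (A x12 / |x12|^2) = A. *)
  set A := gainA _ _ _ _ _.
  by field; rewrite p0 !gt_eqF.
rewrite !sqr_enorm2 -subr_ge0.
(* The slack as a sum of squares. Since eps = beta / alpha, the gain supplies |x34|^2 / (4 beta),
   which completes the square in d, and its term alpha H0 cancels. Then H0 / L = |x12|^2 / 2 + C /
   (2 L) |x34|^2 completes the square in v and leaves the last term. *)
have -> : - (alpha - L^-1) * H0 L C p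
     + (beta * (d 0 0 ^+ 2 + d 1 0 ^+ 2) + (v 0 0 ^+ 2 + v 1 0 ^+ 2) / 2)
     - (p 2 0 * d 0 0 + p 3 0 * d 1 0 + (p 0 0 * v 0 0 + p 1 0 * v 1 0)
    + gainA L C alpha (beta / alpha) p) =
   beta * ((d 0 0 - p 2 0 / (2 * beta)) ^+ 2 + (d 1 0 - p 3 0 / (2 * beta)) ^+ 2)
   + ((v 0 0 - p 0 0) ^+ 2 + (v 1 0 - p 1 0) ^+ 2) / 2
   + C / (2 * L) * (p 2 0 ^+ 2 + p 3 0 ^+ 2).
  by rewrite /H0 /gainA; field; rewrite !gt_eqF.
by rewrite !addr_ge0 ?mulr_ge0 ?addr_ge0 ?sqr_ge0 ?divr_ge0 ?invr_ge0 ?mulr_ge0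
  ?ltW // ltW.
Qed.

Lemma le_sup_enorm2 (R : realType) (n : nat) (I : set R)
    (w : R -> 'cV[R]_n) (t : R) :
  I t -> ((enorm (w t) ^+ 2)%:E <= sup_enorm2 I w)%E.
Proof. by move=> It; apply: ereal_sup_ubound; exists t. Qed.

(** A time in [I] rules out the empty supremum, which is -oo. *)
Lemma sup_enorm2_ge0 (R : realType) (n : nat) (I : set R)
    (w : R -> 'cV[R]_n) (t : R) : I t -> (0 <= sup_enorm2 I w)%E.
Proof.
by move=> /(le_sup_enorm2 w); apply: le_trans; rewrite lee_fin sqr_ge0.
Qed.

Lemma fin_sup_enorm2 (R : realType) (n : nat) (I : set R)
    (w : R -> 'cV[R]_n) (t : R) :
  I t -> (sup_enorm2 I w < +oo)%E -> sup_enorm2 I w \is a fin_num.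
Proof. by move=> It wfin; rewrite ge0_fin_numE// (sup_enorm2_ge0 _ It). Qed.

Lemma H0_ge0 (R : realType) (L C : R) (p : 'cV[R]_4) :
  0 <= L -> 0 <= C -> 0 <= H0 L C p.
Proof.
by move=> L0 C0; rewrite /H0 addr_ge0 ?mulr_ge0 ?divr_ge0 ?addr_ge0 ?sqr_ge0.
Qed.

(** Real bounds [D], [V] stand in for the extended suprema, so that one estimate serves both claims
    of the theorem. It is Gronwall on [0, T] with K = beta D + V / 2. *)
Lemma H0_le_of_input_bounds (R : realType) (L C omega alpha beta rho D V T : R)
    (I : set R) (x : R -> 'cV[R]_4) (d u v : R -> 'cV[R]_2) :
  0 < L -> 0 < C -> 0 < alpha -> 0 < beta -> rho = alpha - L^-1 -> 0 < rho ->
  is_interval I -> I 0 -> I T -> 0 <= T ->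
  solves_on L C omega I x d u ->
  (forall t, I t -> u t = v t + feedback L C alpha (beta / alpha) (x t)) ->
  (forall t, I t -> x t 0 0 ^+ 2 + x t 1 0 ^+ 2 != 0) ->
  (forall t, I t -> enorm (d t) ^+ 2 <= D) ->
  (forall t, I t -> enorm (v t) ^+ 2 <= V) ->
  H0 L C (x T) <= H0 L C (x 0) * expR (- rho * T)
                  + beta / rho * D + (2 * rho)^-1 * V.
Proof.
move=> L0 C0 alpha0 beta0 rhoE rho0 Iitv I0 IT T0 [xc xd] uE xreg dD vV.
pose w t := vector_field L C omega (x t) (d t) (u t).
pose K := beta * D + V / 2.
have K0 : 0 <= K.
  rewrite addr_ge0 ?divr_ge0 ?mulr_ge0 ?(ltW beta0)//.
    exact: le_trans (sqr_ge0 _) (dD _ I0).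
  exact: le_trans (sqr_ge0 _) (vV _ I0).
have sub : `[0, T] `<=` I.
  by move=> t /=; rewrite in_itv /= => t0T; exact: Iitv I0 IT _ t0T.
(* The differential equation is available only in the interior of [I]. *)
have subo : `]0, T[ `<=` I°.
  rewrite -open_subsetE; last exact: interval_open.
  by apply: subset_trans sub; exact: subset_itv_oo_cc.
have rhon0 : rho != 0 by rewrite gt_eqF.
have HT : H0 L C (x T)
    <= (H0 L C (x 0) - K / rho) * expR (- rho * (T - 0)) + K / rho.
  apply: (@gronwall R (H0 L C \o x)
    (fun t => L * (x t 0 0 * w t 0 0 + x t 1 0 * w t 1 0)
            + C * (x t 2 0 * w t 2 0 + x t 3 0 * w t 3 0))
    0 T rho K rhon0 T0) => t.
  - apply: (continuous_comp (continuous_subspaceW sub xc (x := t))).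
    exact: (@continuous_H0 R L C (x t)).
  - by move=> t0T; exact: (is_derive_H0 L C (xd t (subo t t0T))).
  - move=> t0T; have It := interior_subset (subo t t0T).
    apply: le_trans (power_balance L0 C0 alpha0 beta0 (xreg t It) _) _.
      by rewrite /w uE.
    rewrite rhoE lerD2l lerD//; first by rewrite ler_pM2l// dD.
    by rewrite ler_pM2r ?invr_gt0// vV.
apply: le_trans HT _; rewrite subr0.
(* This is the amount by which Gronwall's bound is sharper than the claim. *)
have : 0 <= K / rho * expR (- rho * T).
  by rewrite mulr_ge0 ?expR_ge0 ?divr_ge0// ltW.
have -> : (2 * rho)^-1 * V = K / rho - beta / rho * D by rewrite /K; field.
lra.
Qed.

Theorem theorem3p4 (R : realType) (L C omega alpha beta eps rho : R)
    (I : set R) (x : R -> 'cV[R]_4) (d u v : R -> 'cV[R]_2)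
    (hL : 0 < L) (hC : 0 < C) (homega : 0 < omega)
    (halpha : 0 < alpha) (hbeta : 0 < beta)
    (heps : eps = beta / alpha) (hrho : rho = alpha - L^-1)
    (hI : is_interval I) (hI0 : I 0) (hIpos : forall t : R, I t -> 0 <= t)
    (hx : solves_on L C omega I x d u)
    (hu : forall t : R, I t -> u t = v t + feedback L C alpha eps (x t))
    (hreg : forall t : R, I t -> x t 0 0 ^+ 2 + x t 1 0 ^+ 2 != 0) :
  (0 < rho -> forall T : R, I T ->
     ((H0 L C (x T))%:E <=
        (H0 L C (x 0) * expR (- rho * T))%:E
        + (beta / rho)%:E * sup_enorm2 I d
        + (2 * rho)^-1%:E * sup_enorm2 I v)%E) /\
  (L^-1 < alpha ->
     (sup_enorm2 I d < +oo)%E -> (sup_enorm2 I v < +oo)%E ->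
     [bounded H0 L C (x t) | t in I]).
Proof.
subst eps.
have bound T D V := @H0_le_of_input_bounds R L C omega alpha beta rho D V T
  I x d u v hL hC halpha hbeta hrho.
split.
- move=> rho0 T IT.
  (* An infinite supremum has a positive coefficient and the other summands are not -oo, so the
     right-hand side is +oo. *)
  have [dfin|] := ltP (sup_enorm2 I d) +oo%E; last first.
    rewrite leye_eq => /eqP ->; rewrite gt0_muley ?lte_fin ?divr_gt0//.
    rewrite addey// addye ?leey//.
    by rewrite -ltNye (lt_le_trans ltNy0)// mule_ge0 ?(sup_enorm2_ge0 _ hI0)//
      lee_fin invr_ge0 mulr_ge0// ltW.
  have dK := fineK (fin_sup_enorm2 hI0 dfin).
  have [vfin|] := ltP (sup_enorm2 I v) +oo%E; last first.
    rewrite leye_eq => /eqP ->; rewrite gt0_muley ?lte_fin ?invr_gt0 ?mulr_gt0//.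
    by rewrite -dK -EFinM -EFinD addey ?leey.
  have vK := fineK (fin_sup_enorm2 hI0 vfin).
  rewrite -dK -vK -!EFinM -!EFinD lee_fin; apply: bound => //.
  + exact: hIpos.
  + by move=> t It; rewrite -lee_fin dK le_sup_enorm2.
  + by move=> t It; rewrite -lee_fin vK le_sup_enorm2.
- move=> aL dfin vfin.
  have rho0 : 0 < rho by rewrite hrho subr_gt0.
  have dK := fineK (fin_sup_enorm2 hI0 dfin).
  have vK := fineK (fin_sup_enorm2 hI0 vfin).
  have PF : ProperFilter (globally I) := globally_properfilter hI0.
  apply/ex_bound.
  exists (H0 L C (x 0) + beta / rho * fine (sup_enorm2 I d)
          + (2 * rho)^-1 * fine (sup_enorm2 I v)) => T IT /=.
  rewrite ger0_norm ?H0_ge0 ?(ltW hL) ?(ltW hC)//.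
  apply: le_trans (bound T (fine (sup_enorm2 I d)) (fine (sup_enorm2 I v))
    rho0 hI hI0 IT (hIpos T IT) hx hu hreg _ _) _.
  + by move=> t It; rewrite -lee_fin dK le_sup_enorm2.
  + by move=> t It; rewrite -lee_fin vK le_sup_enorm2.
  (* The bound is uniform in [T] because e^(- rho T) <= 1 for rho, T >= 0. *)
  rewrite !lerD2r ler_piMr ?H0_ge0 ?(ltW hL) ?(ltW hC)// -expR0 ler_expR.
  by rewrite mulNr oppr_le0 mulr_ge0 ?(ltW rho0) ?hIpos.
Qed.
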